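(* Let $R$ and $S$ be commutative rings with identity, $f:R\to S$ a ring homomorphism (preserving identities), and $J$ a non-zero proper ideal of $S$ with $J\subseteq \mathrm{Nil}(S)$. Suppose that: (b) for every $r\in \mathrm{Reg}(R)$ and every $j\in J\setminus\{0\}$, $jf(r)\neq 0$; (c) for every $r\in Z(R)\setminus\{0\}$ and every $j\in J\setminus\{0\}$, $jf(r)=0$; and that the property (a) $Z(R)^2=0$ does not hold. Then $\mathrm{diam}(\Gamma(R\bowtie^f J))=2$.
   Context: The amalgamation of $R$ with $S$ along $J$ with respect to $f$ is the subring $R\bowtie^f J=\{(r,f(r)+j)\mid r\in R,\ j\in J\}$ of $R\times S$. For a commutative ring $A$, $Z(A)$ is the set of zero-divisors of $A$ (including $0$), $\mathrm{Reg}(A)=A\setminus Z(A)$ is the set of regular elements, and $\mathrm{Nil}(A)$ is the set of nilpotent elements; $Z(A)^2=0$ means $xy=0$ for all $x,y\in Z(A)$ (including $x=y$). The zero-divisor graph $\Gamma(A)$ is the undirected graph with vertex set $Z(A)\setminus\{0\}$ in which distinct vertices $x,y$ are adjacent if and only if $xy=0$. The diameter $\mathrm{diam}(G)$ of a connected graph $G$ is the supremum of the distances (lengths of shortest paths) between its vertices. *)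

(* Defs.v *)
From HB Require Import structures.
From mathcomp Require Import all_boot all_order all_algebra.
From mathcomp Require Import boolp classical_sets.

Set Implicit Arguments.
Unset Strict Implicit.
Unset Printing Implicit Defensive.

Import GRing.Theory.
Local Open Scope ring_scope.

Section Elements.
Variable A : comNzRingType.

(* 0 is a zero-divisor, since 1 != 0 in A. *)
Definition zero_divisor (x : A) : Prop := exists2 y : A, y != 0 & x * y = 0.

Definition regular (x : A) : Prop := ~ zero_divisor x.

Definition nilpotent_elt (x : A) : Prop := exists n : nat, x ^+ n = 0.

Definition zero_divisors_sq0 : Prop :=
  forall x y : A, zero_divisor x -> zero_divisor y -> x * y = 0.

End Elements.

Section Amalgamation.
Variables (R S : comNzRingType) (f : {rmorphism R -> S}) (J : idealr S).

Definition amalg_pred : {pred R * S} :=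
  fun x => `[< exists (r : R) (j : S), j \in J /\ x = (r, f r + j) >].

Fact amalg_subring_closed : subring_closed amalg_pred.
Proof.
split=> [|x y /asboolP[r [j [Jj ->]]] /asboolP[s [i [Ji ->]]]
         |x y /asboolP[r [j [Jj ->]]] /asboolP[s [i [Ji ->]]]]; apply/asboolP.
- by exists 1, 0; rewrite rpred0 rmorph1 addr0.
- exists (r - s), (j - i); split; first by rewrite rpredB.
  by rewrite rmorphB addrACA -opprD.
- exists (r * s), (f r * i + f s * j + j * i); split.
    by rewrite !rpredD // idealMr.
  congr pair; rewrite rmorphM mulrDl !mulrDr -!addrA.
  by rewrite [j * f s]mulrC.
Qed.

HB.instance Definition _ :=
  GRing.isSubringClosed.Build (R * S)%type amalg_pred amalg_subring_closed.

Record amalgamation :=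
  Amalgamation { amalg_val : R * S; _ : amalg_val \in amalg_pred }.

HB.instance Definition _ := [isSub for amalg_val].
HB.instance Definition _ := [Choice of amalgamation by <:].
HB.instance Definition _ := [SubChoice_isSubComNzRing of amalgamation by <:].

End Amalgamation.

(* Graphs are given by a Boolean adjacency relation on a type of vertices,
   which may be infinite. *)
Section Graphs.
Variables (V : eqType) (e : rel V).

Definition path_of_length (x y : V) (n : nat) : Prop :=
  exists p : seq V, [/\ path e x p, last x p = y, uniq (x :: p) & size p = n].

Definition connected_graph : Prop :=
  forall x y : V, exists n : nat, path_of_length x y n.

Definition distance_is (x y : V) (n : nat) : Prop :=
  path_of_length x y n /\ forall m : nat, path_of_length x y m -> (n <= m)%N.

Definition distances : set nat := [set n | exists x y : V, distance_is x y n].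

(* When the distances are unbounded, or the graph is not connected, this holds
   for no d. *)
Definition diameter_is (d : nat) : Prop :=
  connected_graph /\ supremums distances d.

End Graphs.

Section ZeroDivisorGraph.
Variable A : comNzRingType.

Definition zdg_vertex : Type := {x : A | `[< zero_divisor x /\ x <> 0 >]}.

HB.instance Definition _ := Choice.on zdg_vertex.

Definition zero_divisor_graph : rel zdg_vertex :=
  fun x y => (x != y) && (sval x * sval y == 0).

End ZeroDivisorGraph.

(* Main.v *)
Require Import Defs.
From HB Require Import structures.
From mathcomp Require Import all_boot all_order all_algebra.
From mathcomp Require Import boolp classical_sets.

Import GRing.Theory.
Local Open Scope ring_scope.

(** Write an element of the amalgamation as [(r, f r + j)].  Multiplying a
    nonzero element of [J] by the largest power of a nilpotent [j] that does
    not kill it produces a nonzero element of [J] killed by [j].  This trick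
    is used twice.

    It shows that a zero-divisor [(r, f r + j)] has [r] in [Z(R)]
    ([zero_divisor_fst]): otherwise the annihilator would have the form
    [(0, k)] with [k f(r) = - k j], and replacing [k] by a multiple killed by
    [j] would contradict (b).

    It also gives, for [j] and [k] in [J], a single [l != 0] in [J] killed by
    both.  Since [l] is killed by [f(r)] for each [r] in [Z(R)] by (c), the
    element [(0, l)] annihilates any two prescribed zero-divisors
    ([common_annihilator]).  So any two vertices are at distance at most 2:
    [(0, l)] is a common neighbour unless it is one of the two vertices, and
    then these are adjacent or equal.

    The value 2 is attained because (a) fails: if [x y != 0] in [Z(R)], then
    [(x, f x)] and [(y, f y + j)] with [j != 0] in [J] are vertices whose
    product is nonzero; the shift by [j] keeps them distinct when [x = y]. *)

(** * Diameter two from common annihilators *)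

Lemma path_of_length1 {V : eqType} {e : rel V} {x y : V} :
  x != y -> e x y -> path_of_length e x y 1.
Proof.
by move=> xy exy; exists [:: y]; split=> //=; rewrite ?exy // inE xy.
Qed.

Lemma path_of_length2 {V : eqType} {e : rel V} {x z y : V} :
  uniq [:: x; z; y] -> e x z -> e z y -> path_of_length e x y 2.
Proof. by move=> uxzy exz ezy; exists [:: z; y]; split=> //=; rewrite exz ezy. Qed.

Lemma path_of_length_ge2 {V : eqType} {e : rel V} {x y : V} {n : nat} :
  x != y -> ~~ e x y -> path_of_length e x y n -> (2 <= n)%N.
Proof.
move=> xy nexy [[|z [|t p]] [/= pp lp _ <-]] //.
  by rewrite lp eqxx in xy.
by rewrite -lp andbT in nexy pp *; rewrite pp in nexy.
Qed.

(** The common annihilator [z] of two vertices is itself a vertex; if it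
    coincides with one of them then the two vertices already annihilate each
    other, so a path of length at most 2 exists in every case. *)
Lemma zero_divisor_graph_path_le2 {A : comNzRingType}
    (ann : forall a b : A, zero_divisor a -> zero_divisor b ->
       exists2 z : A, z != 0 & a * z = 0 /\ b * z = 0)
    (x y : zdg_vertex A) :
  exists2 n, (n <= 2)%N & path_of_length (@zero_divisor_graph A) x y n.
Proof.
have [/asboolP[Zx x0] /asboolP[Zy y0]] := (svalP x, svalP y).
have [<-|xy] := eqVneq x y; first by exists 0%N => //; exists [::]; split.
have [exy|] := boolP (zero_divisor_graph x y).
  by exists 1%N => //; apply: path_of_length1.
rewrite /zero_divisor_graph xy /= => xy0.
have [z z0 [xz yz]] := ann _ _ Zx Zy.
have zP : `[< zero_divisor z /\ z <> 0 >].
  apply/asboolP; split; last exact/eqP.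
  by exists (sval x); [exact/eqP | rewrite mulrC].
pose v : zdg_vertex A := exist _ z zP.
have xv : x != v by apply: contraNneq xy0 => ->; rewrite /= mulrC yz.
have yv : y != v by apply: contraNneq xy0 => ->; rewrite /= xz.
exists 2%N => //; apply: (@path_of_length2 _ _ x v y).
- by rewrite /= !inE negb_or xv xy eq_sym yv.
- by rewrite /zero_divisor_graph xv /= xz eqxx.
- by rewrite /zero_divisor_graph eq_sym yv /= mulrC yz eqxx.
Qed.

Lemma zero_divisor_graph_diameter2 {A : comNzRingType}
    (ann : forall a b : A, zero_divisor a -> zero_divisor b ->
       exists2 z : A, z != 0 & a * z = 0 /\ b * z = 0)
    {a b : A} (Za : zero_divisor a) (Zb : zero_divisor b)
    (ab : a != b) (ab0 : a * b != 0) :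
  diameter_is (@zero_divisor_graph A) 2.
Proof.
have path_le2 := zero_divisor_graph_path_le2 ann.
split; first by move=> x y; have [n _ pn] := path_le2 x y; exists n.
split=> [n [x [y [_ minn]]]|u ub_u].
  have [m m2 /minn nm] := path_le2 x y.
  exact: leq_trans nm m2.
have aP : `[< zero_divisor a /\ a <> 0 >].
  by apply/asboolP; split=> // a0; rewrite a0 mul0r eqxx in ab0.
have bP : `[< zero_divisor b /\ b <> 0 >].
  by apply/asboolP; split=> // b0; rewrite b0 mulr0 eqxx in ab0.
pose x : zdg_vertex A := exist _ a aP.
pose y : zdg_vertex A := exist _ b bP.
have xy : x != y by apply: contraNneq ab => /(congr1 sval) /= ->.
have nexy : ~~ zero_divisor_graph x y.
  by rewrite /zero_divisor_graph negb_and /= ab0 orbT.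
apply: ub_u; exists x, y.
have [n n2 pn] := path_le2 x y.
have n2' := path_of_length_ge2 xy nexy pn.
have -> : 2%N = n by apply/eqP; rewrite eqn_leq n2' n2.
split=> // m /(path_of_length_ge2 xy nexy).
exact: leq_trans.
Qed.

(** * Annihilators inside a nil ideal *)

Lemma nilpotent_last_power {A : comNzRingType} {j k : A} :
  nilpotent_elt j -> k != 0 ->
  exists2 n, j ^+ n * k != 0 & j * (j ^+ n * k) = 0.
Proof.
move=> [n jn] k0.
have ex_n : exists m, j ^+ m * k == 0 by exists n; rewrite jn mul0r.
case: (ex_minnP ex_n) => -[|m] m0 minm.
  by rewrite expr0 mul1r (negPf k0) in m0.
exists m; last by rewrite mulrA -exprS; apply/eqP.
by apply/negP => /minm; rewrite ltnn.
Qed.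

Lemma nil_ideal_common_annihilator {S : comNzRingType} {J : idealr S}
    (J_neq0 : exists2 j : S, j \in J & j != 0)
    (J_nil : forall j : S, j \in J -> nilpotent_elt j) {j k : S} :
  j \in J -> k \in J ->
  exists l : S, [/\ l \in J, l != 0, j * l = 0 & k * l = 0].
Proof.
move=> Jj Jk; have [i Ji i0] := J_neq0.
have [m m0 jm] := nilpotent_last_power (J_nil j Jj) i0.
have [n n0 kn] := nilpotent_last_power (J_nil k Jk) m0.
(* The last power of [k] is taken relative to [j ^+ m * i] rather than [i], so
   that the product is nonzero and stays killed by [j]. *)
exists (k ^+ n * (j ^+ m * i)); split=> //.
  by rewrite !idealMr.
by rewrite mulrCA jm mulr0.
Qed.

(** * Zero-divisors of the amalgamation *)

Section AmalgamationElements.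
Context {R S : comNzRingType} (f : {rmorphism R -> S}) {J : idealr S}.

Lemma amalg_elt_subproof (r : R) {j : S} :
  j \in J -> (r, f r + j) \in amalg_pred f J.
Proof. by move=> Jj; apply/asboolP; exists r, j. Qed.

Definition amalg_elt (r : R) {j : S} (Jj : j \in J) : amalgamation f J :=
  Amalgamation (amalg_elt_subproof r Jj).

Lemma amalg_eltP (x : amalgamation f J) :
  exists r j (Jj : j \in J), x = amalg_elt r Jj.
Proof.
case: x => x Px; have /asboolP[r [j [Jj xE]]] := Px.
by exists r, j, Jj; apply: val_inj.
Qed.

Lemma amalg_elt_eq0 (r : R) {j : S} (Jj : j \in J) :
  (amalg_elt r Jj == 0) = (r == 0) && (j == 0).
Proof.
rewrite -val_eqE /= xpair_eqE.
by have [->|//] := eqVneq r 0; rewrite rmorph0 add0r.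
Qed.

Lemma amalg_elt_mul0 (r : R) {j l : S} (Jj : j \in J) (Jl : l \in J) :
  l * f r = 0 -> j * l = 0 -> amalg_elt r Jj * amalg_elt 0 Jl = 0.
Proof.
move=> lr jl; apply: val_inj; rewrite /=; congr pair; first by rewrite /= mulr0.
by rewrite /= rmorph0 add0r mulrDl [f r * l]mulrC lr jl addr0.
Qed.

End AmalgamationElements.

(** If [(0, k)] annihilates [(r, f r + j)], then so does [(0, j ^+ n * k)];
    for the last nonzero such multiple [k'] the term in [j] vanishes and
    [k' * f r = 0], which (b) forbids for a regular [r]. *)
Lemma zero_divisor_fst {R S : comNzRingType} {f : {rmorphism R -> S}}
    {J : idealr S}
    (J_nil : forall j : S, j \in J -> nilpotent_elt j)
    (hb : forall (r : R) (j : S),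
        regular r -> j \in J -> j != 0 -> j * f r != 0)
    {r : R} {j : S} {Jj : j \in J} :
  zero_divisor (amalg_elt f r Jj) -> zero_divisor r.
Proof.
move=> [y]; have [s [k [Jk ->]]] := amalg_eltP _ y.
rewrite amalg_elt_eq0 => sk0 /(congr1 val) [/= rs0].
have [s0|s0 _] := eqVneq s 0; last by exists s.
rewrite s0 eqxx /= in sk0; rewrite s0 rmorph0 add0r => rjk.
apply: contrapT => reg_r.
have [n n0 jn] := nilpotent_last_power (J_nil j Jj) sk0.
have Jn : j ^+ n * k \in J by rewrite idealMr.
have /eqP[] := hb r _ reg_r Jn n0.
(* Adding back the vanishing term [j * (j ^+ n * k)] makes the annihilated
   product [(f r + j) * k] reappear. *)
by rewrite -[LHS](addr0) -[in LHS]jn [_ * f r]mulrC -mulrDl mulrCA rjk mulr0.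
Qed.

Lemma common_annihilator {R S : comNzRingType} {f : {rmorphism R -> S}}
    {J : idealr S}
    (J_neq0 : exists2 j : S, j \in J & j != 0)
    (J_nil : forall j : S, j \in J -> nilpotent_elt j)
    (hc : forall (r : R) (j : S),
        zero_divisor r -> r != 0 -> j \in J -> j != 0 -> j * f r = 0)
    (r s : R) (j k : S) (Jj : j \in J) (Jk : k \in J) :
  zero_divisor r -> zero_divisor s ->
  exists2 z : amalgamation f J, z != 0 &
    amalg_elt f r Jj * z = 0 /\ amalg_elt f s Jk * z = 0.
Proof.
move=> Zr Zs.
have [l [Jl l0 jl kl]] := nil_ideal_common_annihilator J_neq0 J_nil Jj Jk.
have lZ0 t : zero_divisor t -> l * f t = 0.
  have [-> _|t0 Zt] := eqVneq t 0; first by rewrite rmorph0 mulr0.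
  exact: hc.
exists (amalg_elt f 0 Jl); first by rewrite amalg_elt_eq0 eqxx.
by split; apply: amalg_elt_mul0; rewrite ?lZ0.
Qed.

Theorem theorem4p1 (R S : comNzRingType) (f : {rmorphism R -> S})
    (J : idealr S)
    (J_neq0 : exists2 j : S, j \in J & j != 0)
    (J_nil : forall j : S, j \in J -> nilpotent_elt j)
    (hb : forall (r : R) (j : S),
        regular r -> j \in J -> j != 0 -> j * f r != 0)
    (hc : forall (r : R) (j : S),
        zero_divisor r -> r != 0 -> j \in J -> j != 0 -> j * f r = 0)
    (not_ha : ~ zero_divisors_sq0 R) :
  diameter_is (@zero_divisor_graph (amalgamation f J)) 2.
Proof.
have ann := common_annihilator J_neq0 J_nil hc.
have [x [y [Zx Zy xy0]]] :
    exists x y : R, [/\ zero_divisor x, zero_divisor y & x * y != 0].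
  apply: contrapT => nex; apply: not_ha => x y Zx Zy.
  by apply/eqP/negPn/negP => xy0; apply: nex; exists x, y.
have [j Jj j0] := J_neq0.
have J0 : 0 \in J by rewrite rpred0.
have [z z0 [xz yz]] := ann x y _ _ J0 Jj Zx Zy.
apply: (@zero_divisor_graph_diameter2 _ _ (amalg_elt f x J0) (amalg_elt f y Jj)).
- move=> a b; have [r [i [Ji ->]]] := amalg_eltP _ a.
  have [s [k [Jk ->]]] := amalg_eltP _ b.
  move=> /(zero_divisor_fst J_nil hb) Zr /(zero_divisor_fst J_nil hb) Zs.
  exact: ann.
- by exists z.
- by exists z.
- apply: contraNneq j0 => /(congr1 val) [/= ->].
  by move=> /addrI ->.
- by apply: contraNneq xy0 => /(congr1 val) [/= ->].
Qed.
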